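(* Let $\Omega$ be a quasi-product with quasi-factor $\Lambda$ and stable quasi-factor $\Gamma$. For any $p\in G(\Lambda)^*$ and $q\in G(\Gamma)^*$ we have $[q]_{s(p)}=[q]_{r(p)}$. In particular, if $\Lambda$ is connected, then for every $v,w\in\Lambda^0$ the factorization rules in $\Omega_2^v$ and $\Omega_2^w$ agree (that is, $[q]_v=[q]_w$ for all $q\in G(\Gamma)^*$).
   Context: Conventions: $\mathbb N=\{0,1,2,\dots\}$ and $e_1,\dots,e_k$ is the standard basis of $\mathbb N^k$. A $k$-graph is a countable category $\Lambda$ (objects identified with identity morphisms) with a functor $d:\Lambda\to\mathbb N^k$ such that whenever $d(\lambda)=m+n$ there are unique $\mu,\nu\in\Lambda$ with $\lambda=\mu\nu$, $d(\mu)=m$, $d(\nu)=n$. Write $\Lambda^0=d^{-1}(0)$, and $r(\lambda),s(\lambda)$ for range and source; $\mu\nu$ is defined when $s(\mu)=r(\nu)$. The one-skeleton $G(\Lambda)$ is the edge-colored directed graph with vertex set $\Lambda^0$, edge set $\{\lambda: d(\lambda)\in\{e_1,\dots,e_k\}\}$, source and range inherited from $\Lambda$, and $d(e)$ as the color of $e$. $\Lambda$ is connected if the undirected graph underlying $G(\Lambda)$ is connected. Isomorphisms of edge-colored directed graphs preserve source, range and color. For a directed graph $G$, $G^*$ is its category of finite paths $p_1\cdots p_n$ with $s(p_i)=r(p_{i+1})$ (vertices are paths of length $0$). The color order of $p_1\cdots p_n$ is $(d(p_1),\dots,d(p_n))$. Two paths in $G(\Lambda)^*$ are equivalent if they have the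 same composite in $\Lambda$; $[p]$ denotes the class (composite) of $p$; this equivalence relation is called the factorization rule of $\Lambda$. By the factorization property, for each path $p$ and each permutation of its color order there is exactly one path equivalent to $p$ with that color order. If $\Lambda$ is a $k_1$-graph and $\Gamma$ a $k_2$-graph, $\Lambda\times\Gamma$ is the product $(k_1+k_2)$-graph with degree $(d_\Lambda,d_\Gamma)$. Its one-skeleton has vertices $\Lambda^0\times\Gamma^0$ and edges $(e,v)$ ($e$ an edge of $G(\Lambda)$, $v\in\Gamma^0$; colored as $e$) and $(x,f)$ ($x\in\Lambda^0$, $f$ an edge of $G(\Gamma)$; colored $e_{k_1+j}$ if $f$ has color $e_j$), with source and range computed coordinatewise. A $(k_1+k_2)$-graph $\Omega$ is a quasi-product with quasi-factors $\Lambda$ (a $k_1$-graph) and $\Gamma$ (a $k_2$-graph) if: (i) $G(\Omega)\cong G(\Lambda\times\Gamma)$; (ii) there are injective functors $\psi_1:\Lambda\to\Omega$ and $\psi_2:\Gamma\to\Omega$; (iii) $d_\Lambda=\pi_1 d_\Omega\psi_1$ and $d_\Gamma=\pi_2d_\Omega\psi_2$, where $\pi_i:\mathbb N^{k_1}\times\mathbb N^{k_2}\to\mathbb N^{k_i}$ are the projections. One fixes the identification $G(\Omega)=G(\Lambda\times\Gamma)$ and labels edges and paths of $G(\Omega)$ accordingly. Put $\Omega_1=d^{-1}(\mathbb N^{k_1}\times\{0\})$, $\Omega_2=d^{-1}(\{0\}\times\mathbb N^{k_2})$. Then $\Omega_1=\bigsqcup_{w\in\Gamma^0}\Omega_1^w\times\{w\}$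 and $\Omega_2=\bigsqcup_{x\in\Lambda^0}\{x\}\times\Omega_2^x$, where $\Omega_1^w\times\{w\}$ (resp. $\{x\}\times\Omega_2^x$) is the $k_1$-graph (resp. $k_2$-graph) of all elements of $\Omega$ represented by paths in $G(\Lambda)\times\{w\}$ (resp. $\{x\}\times G(\Gamma)$). For $p\in G(\Lambda)^*$, $([p],w)$ denotes the element of $\Omega_1^w\times\{w\}$ represented by the path $(p,w)$; similarly $(x,[q])$ for $q\in G(\Gamma)^*$. For $x\in\Lambda^0$ and $q\in G(\Gamma)^*$, $[q]_x\subseteq G(\Gamma)^*$ denotes the equivalence class of $q$ with respect to the factorization rule of $\Omega_2^x$, i.e. the set of $q'\in G(\Gamma)^*$ such that $(x,q)$ and $(x,q')$ represent the same element of $\Omega$. Given $p\in G(\Lambda)^*$ and $q\in G(\Gamma)^*$, the element $([p],r(q))(s(p),[q])\in\Omega$ factors uniquely as $\beta\alpha$ with $\beta\in\Omega_2$, $\alpha\in\Omega_1$. Here $d(\beta)=d(s(p),[q])$, $d(\alpha)=d([p],r(q))$, $\beta\in\{r(p)\}\times\Omega_2^{r(p)}$ and $\alpha\in\Omega_1^{s(q)}\times\{s(q)\}$. Define $p_\vartriangleright(q)\in G(\Gamma)^*$ to be the unique path with the same color order as $q$ such that $(r(p),[p_\vartriangleright(q)])=\beta$. This gives a color-order-, source- and range-preserving map $p_\vartriangleright:G(\Gamma)^*\to G(\Gamma)^*$. $\Gamma$ is a stable quasi-factor of $\Omega$ if $p_\vartriangleright=\mathrm{id}$ on $G(\Gamma)^*$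 for all $p\in G(\Lambda)^*$. *)

(* Defs.v *)
From HB Require Import structures.
From mathcomp Require Import all_boot all_order all_algebra.
From Stdlib Require Import Relations.Relation_Operators.

Set Implicit Arguments.
Unset Strict Implicit.
Unset Printing Implicit Defensive.

Import GRing.Theory.
Local Open Scope ring_scope.

(* Elements of N^k are row vectors over nat, so that N^k1 x N^k2 is
   'rV[nat]_(k1 + k2), with projections lsubmx and rsubmx.  A pair (mu, nu) of
   morphisms is composable when src mu = rng nu; comp is total, and its values
   on non-composable pairs are arbitrary and never used. *)
Record kgraph (k : nat) := KGraph {
  obj : countType;
  mor : countType;
  src : mor -> obj;
  rng : mor -> obj;
  idm : obj -> mor;
  comp : mor -> mor -> mor;
  deg : mor -> 'rV[nat]_k;
  src_id : forall v, src (idm v) = v;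
  rng_id : forall v, rng (idm v) = v;
  src_comp : forall l m, src l = rng m -> src (comp l m) = src m;
  rng_comp : forall l m, src l = rng m -> rng (comp l m) = rng l;
  comp_idl : forall l, comp (idm (rng l)) l = l;
  comp_idr : forall l, comp l (idm (src l)) = l;
  comp_assoc : forall l m n, src l = rng m -> src m = rng n ->
    comp l (comp m n) = comp (comp l m) n;
  deg_id : forall v, deg (idm v) = 0;
  deg_comp : forall l m, src l = rng m -> deg (comp l m) = deg l + deg m;
  factorization : forall (l : mor) (m n : 'rV[nat]_k), deg l = m + n ->
    exists! mn : mor * mor, [/\ src mn.1 = rng mn.2, l = comp mn.1 mn.2,
                                deg mn.1 = m & deg mn.2 = n]
}.

Arguments src {k _} _.
Arguments rng {k _} _.
Arguments idm {k _} _.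
Arguments comp {k _} _ _.
Arguments deg {k _} _.

Record kfunctor k1 k2 (L : kgraph k1) (M : kgraph k2) := KFunctor {
  fobj : obj L -> obj M;
  fmor :> mor L -> mor M;
  fsrc : forall l, src (fmor l) = fobj (src l);
  frng : forall l, rng (fmor l) = fobj (rng l);
  fid : forall v, fmor (idm v) = idm (fobj v);
  fcomp : forall l m, src l = rng m -> fmor (comp l m) = comp (fmor l) (fmor m)
}.

Section Product.
Variables (k1 k2 : nat) (L : kgraph k1) (G : kgraph k2).
Let M := (mor L * mor G)%type.
Let psrc (a : M) := (src a.1, src a.2).
Let prng (a : M) := (rng a.1, rng a.2).
Let pid (v : obj L * obj G) : M := (idm v.1, idm v.2).
Let pcomp (a b : M) : M := (comp a.1 b.1, comp a.2 b.2).
Let pdeg (a : M) : 'rV[nat]_(k1 + k2) := row_mx (deg a.1) (deg a.2).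

Fact prod_src_id v : psrc (pid v) = v.
Proof. by case: v => v w; rewrite /psrc /= !src_id. Qed.
Fact prod_rng_id v : prng (pid v) = v.
Proof. by case: v => v w; rewrite /prng /= !rng_id. Qed.
Fact prod_src_comp l m : psrc l = prng m -> psrc (pcomp l m) = psrc m.
Proof. by case=> h1 h2; rewrite /psrc /= !src_comp. Qed.
Fact prod_rng_comp l m : psrc l = prng m -> prng (pcomp l m) = prng l.
Proof. by case=> h1 h2; rewrite /prng /= !rng_comp. Qed.
Fact prod_idl l : pcomp (pid (prng l)) l = l.
Proof. by case: l => l m; rewrite /pcomp /= !comp_idl. Qed.
Fact prod_idr l : pcomp l (pid (psrc l)) = l.
Proof. by case: l => l m; rewrite /pcomp /= !comp_idr. Qed.
Fact prod_assoc l m n : psrc l = prng m -> psrc m = prng n ->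
  pcomp l (pcomp m n) = pcomp (pcomp l m) n.
Proof. by case=> a b [c d]; rewrite /pcomp /= !comp_assoc. Qed.
Fact prod_deg_id v : pdeg (pid v) = 0.
Proof. by rewrite /pdeg /= !deg_id row_mx0. Qed.
Fact prod_deg_comp l m : psrc l = prng m -> pdeg (pcomp l m) = pdeg l + pdeg m.
Proof. by case=> a b; rewrite /pdeg /= !deg_comp // add_row_mx. Qed.
Fact prod_factorization l m n : pdeg l = m + n ->
  exists! mn : M * M, [/\ psrc mn.1 = prng mn.2, l = pcomp mn.1 mn.2,
                          pdeg mn.1 = m & pdeg mn.2 = n].
Proof.
case: l => l1 l2; rewrite /pdeg /= -(hsubmxK m) -(hsubmxK n) add_row_mx.
move: (lsubmx m) (rsubmx m) (lsubmx n) (rsubmx n) => m1 m2 n1 n2.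
move=> /eq_row_mx[/factorization[[a b] [[/= h1 h2 h3 h4] u]]].
move=> /factorization[[a' b'] [[/= h1' h2' h3' h4'] u']].
exists ((a, a'), (b, b')); split=> [|[[c c'] [d d']]] /=.
  split=> /=; first by rewrite /psrc /prng /= h1 h1'.
  - by rewrite /pcomp /= -h2 -h2'.
  - by rewrite h3 h3'.
  - by rewrite h4 h4'.
case=> -[/= e1 e1'] [e2 e2'] /eq_row_mx[e3 e3'] /eq_row_mx[e4 e4'].
have [-> ->] : (a, b) = (c, d) by apply: u.
by have [-> ->] : (a', b') = (c', d') by apply: u'.
Qed.

Definition kprod : kgraph (k1 + k2) :=
  KGraph prod_src_id prod_rng_id prod_src_comp prod_rng_comp prod_idl prod_idr
    prod_assoc prod_deg_id prod_deg_comp prod_factorization.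
End Product.

Record cgraph (C : Type) := CGraph {
  vert : countType;
  edge : countType;
  gsrc : edge -> vert;
  grng : edge -> vert;
  color : edge -> C
}.

Arguments gsrc {C _} _.
Arguments grng {C _} _.
Arguments color {C _} _.

(* Morphisms of the underlying directed graphs; colors are ignored. *)
Record gmorph C D (G : cgraph C) (H : cgraph D) := GMorph {
  gvert : vert G -> vert H;
  gedge : edge G -> edge H;
  gmorph_src : forall e, gsrc (gedge e) = gvert (gsrc e);
  gmorph_rng : forall e, grng (gedge e) = gvert (grng e)
}.

Record ciso C (G H : cgraph C) := CIso {
  ciso_morph :> gmorph G H;
  ciso_vert_bij : bijective (gvert ciso_morph);
  ciso_edge_bij : bijective (gedge ciso_morph);
  ciso_color : forall e, color (gedge ciso_morph e) = color e
}.

Definition connected C (G : cgraph C) : Prop :=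
  forall v w : vert G,
    clos_refl_sym_trans (vert G)
      (fun a b => exists e : edge G, grng e = a /\ gsrc e = b) v w.

Fixpoint is_walk C (G : cgraph C) (v : vert G) (es : seq (edge G)) : bool :=
  if es is e :: es' then (grng e == v) && is_walk (gsrc e) es' else true.

(* The category of finite paths G^*: a path p_1...p_n is stored as its range
   together with the sequence [:: p_1; ...; p_n], where
   gsrc p_i = grng p_(i+1).  The range is needed for paths of length 0. *)
Record gpath C (G : cgraph C) := GPath {
  gpath_val : vert G * seq (edge G);
  gpathP : is_walk gpath_val.1 gpath_val.2
}.

HB.instance Definition _ C (G : cgraph C) := [isSub for @gpath_val C G].
HB.instance Definition _ C (G : cgraph C) := [Countable of gpath G by <:].

Section Paths.
Variables (C : Type) (G : cgraph C).
Implicit Type p : gpath G.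
Definition prng p : vert G := (gpath_val p).1.
Definition pedges p : seq (edge G) := (gpath_val p).2.
Definition psrc p : vert G := last (prng p) (map gsrc (pedges p)).
Definition color_order p : seq C := map color (pedges p).
End Paths.

Lemma walk_map C D (G : cgraph C) (H : cgraph D) (f : gmorph G H) v es :
  is_walk v es -> is_walk (gvert f v) (map (gedge f) es).
Proof.
elim: es v => //= e es IH v /andP[/eqP<- /IH].
by rewrite gmorph_src gmorph_rng eqxx.
Qed.

Definition path_map C D (G : cgraph C) (H : cgraph D) (f : gmorph G H)
    (p : gpath G) : gpath H :=
  @GPath D H (gvert f (prng p), map (gedge f) (pedges p))
    (walk_map f (gpathP p)).

Lemma psrc_map C D (G : cgraph C) (H : cgraph D) (f : gmorph G H) p :
  psrc (path_map f p) = gvert f (psrc p).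
Proof.
rewrite /psrc /= -(last_map (gvert f)) -!map_comp; congr (last _ _).
by apply: eq_map => e /=; rewrite gmorph_src.
Qed.

Definition is_basis k (d : 'rV[nat]_k) : bool := [exists i, d == delta_mx 0 i].

Definition skeleton k (L : kgraph k) : cgraph 'rV[nat]_k :=
  @CGraph _ (obj L) {l : mor L | is_basis (deg l)}
    (fun e => src (val e)) (fun e => rng (val e)) (fun e => deg (val e)).

Definition ecomp k (L : kgraph k) (v : obj L) (es : seq (edge (skeleton L))) :
    mor L :=
  foldr (fun e l => comp (val e) l) (idm (last v (map gsrc es))) es.

(* The element [p] represented by a path p of the one-skeleton. *)
Definition composite k (L : kgraph k) (p : gpath (skeleton L)) : mor L :=
  ecomp (prng p) (pedges p).

Lemma ecomp_rng k (L : kgraph k) (v : vert (skeleton L)) es :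
  is_walk v es -> rng (ecomp (L := L) v es) = v.
Proof.
elim: es v => [|e es IH] v /=; first by rewrite /ecomp /= rng_id.
move=> /andP[/eqP <- w]; have := IH _ w; rewrite /ecomp /= => h.
by rewrite rng_comp // h.
Qed.

Lemma ecomp_src k (L : kgraph k) (v : vert (skeleton L)) es :
  is_walk v es -> src (ecomp (L := L) v es) = last v (map gsrc es).
Proof.
elim: es v => [|e es IH] v /=; first by rewrite /ecomp /= src_id.
move=> /andP[_ w]; have := IH _ w; have := ecomp_rng w; rewrite /ecomp /=.
by move=> h1 h2; rewrite src_comp.
Qed.

Lemma ecomp_deg k (L : kgraph k) (v : vert (skeleton L)) es :
  is_walk v es -> deg (ecomp (L := L) v es) = \sum_(c <- map color es) c.
Proof.
elim: es v => [|e es IH] v /=; first by rewrite /ecomp /= deg_id big_nil.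
move=> /andP[_ w]; have := IH _ w; have := ecomp_rng w; rewrite /ecomp /=.
by move=> h1 h2; rewrite deg_comp // big_cons h2.
Qed.

Lemma composite_rng k (L : kgraph k) (p : gpath (skeleton L)) :
  rng (composite p) = prng p.
Proof. exact: (ecomp_rng (gpathP p)). Qed.
Lemma composite_src k (L : kgraph k) (p : gpath (skeleton L)) :
  src (composite p) = psrc p.
Proof. exact: (ecomp_src (gpathP p)). Qed.
Lemma composite_deg k (L : kgraph k) (p : gpath (skeleton L)) :
  deg (composite p) = \sum_(c <- color_order p) c.
Proof. exact: (ecomp_deg (gpathP p)). Qed.

Lemma deg0_id k (L : kgraph k) (l : mor L) : deg l = 0 -> l = idm (rng l).
Proof.
move=> h; have h' : deg l = 0 + 0 by rewrite addr0.
have [[a b] [_ u]] := factorization h'.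
have /= e1 : (a, b) = (idm (rng l), l).
  by apply: u; split; rewrite /= ?src_id ?comp_idl ?deg_id.
have /= e2 : (a, b) = (l, idm (src l)).
  by apply: u; split; rewrite /= ?rng_id ?comp_idr ?deg_id.
by move: e2; rewrite e1 => -[e _]; rewrite -{1}e.
Qed.

(* For each color order there is a unique path representing a morphism. *)
Lemma path_exists k (L : kgraph k) (cs : seq 'rV[nat]_k) (l : mor L) :
  all (@is_basis k) cs -> deg l = \sum_(c <- cs) c ->
  exists es : seq (edge (skeleton L)),
    [/\ is_walk (G := skeleton L) (rng l) es, map color es = cs
      & ecomp (rng l) es = l].
Proof.
elim: cs l => [|c cs IH] l /=.
  by rewrite big_nil => _ /deg0_id h; exists [::]; split => //; rewrite /ecomp /= -h.
case/andP=> bc bcs; rewrite big_cons => /factorization.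
move=> [[m n] [[/= h1 h2 h3 h4] _]].
have [es [w1 w2 w3]] := IH n bcs h4.
have bm : is_basis (deg m) by rewrite h3.
exists (exist _ m bm :: es); split=> /=.
- by rewrite h2 rng_comp // eqxx h1.
- by rewrite w2 /= h3.
- by rewrite h2 -[n in RHS]w3 -h1.
Qed.

Lemma path_unique k (L : kgraph k) (p q : gpath (skeleton L)) :
  composite p = composite q -> color_order p = color_order q -> p = q.
Proof.
move=> h hc; apply: val_inj; have hr: prng p = prng q by rewrite -!composite_rng h.
case: p q h hc hr => [[v es] /= wp] [[v' fs] /= wq].
rewrite /composite /color_order /prng /pedges /= => h hc hr; congr (_, _) => //.
subst v'; elim: es fs v wp wq h hc => [|e es IH] [|f fs] v //=.
move=> /andP[e1 w1] /andP[f1 w2] h [hc hcs].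
have r1 := ecomp_rng w1; have r2 := ecomp_rng w2.
have d : deg (ecomp (L := L) v (e :: es)) =
    deg (val e) + deg (ecomp (L := L) (gsrc e) es) by rewrite /ecomp /= deg_comp.
have [[a b] [_ u]] := factorization d.
have u1 : (a, b) = (val e, ecomp (L := L) (gsrc e) es).
  by apply: u; split; rewrite //= r1.
have u2 : (a, b) = (val f, ecomp (L := L) (gsrc f) fs).
  apply: u; split; [by rewrite /= r2 | exact: h | by rewrite /= hc |].
  by rewrite /= (ecomp_deg w1) (ecomp_deg w2) hcs.
move: u2; rewrite u1 => -[/val_inj ef eq2]; rewrite -{}ef in w2 eq2 *.
by congr cons; apply: (IH fs (gsrc e)).
Qed.

Section ProductEdges.
Variables (k1 k2 : nat) (L : kgraph k1) (G : kgraph k2).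
Let P := skeleton (kprod L G).

Fact edge_l_subproof (e : edge (skeleton L)) (w : obj G) :
  is_basis (deg ((val e, idm w) : mor (kprod L G))).
Proof.
have /existsP[i /eqP h] := valP e; apply/existsP; exists (lshift k2 i).
by rewrite /= h deg_id delta_mx_lshift.
Qed.

Fact edge_r_subproof (x : obj L) (f : edge (skeleton G)) :
  is_basis (deg ((idm x, val f) : mor (kprod L G))).
Proof.
have /existsP[i /eqP h] := valP f; apply/existsP; exists (rshift k1 i).
by rewrite /= h deg_id delta_mx_rshift.
Qed.

(* The edges (e, w) and (x, f) of the one-skeleton of the product. *)
Definition edge_l (w : obj G) (e : edge (skeleton L)) : edge P :=
  exist _ ((val e, idm w) : mor (kprod L G)) (edge_l_subproof e w).
Definition edge_r (x : obj L) (f : edge (skeleton G)) : edge P :=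
  exist _ ((idm x, val f) : mor (kprod L G)) (edge_r_subproof x f).

Fact incl_l_src w e : gsrc (edge_l w e) = (gsrc e, w).
Proof. by rewrite /= src_id. Qed.
Fact incl_l_rng w e : grng (edge_l w e) = (grng e, w).
Proof. by rewrite /= rng_id. Qed.
Fact incl_r_src x f : gsrc (edge_r x f) = (x, gsrc f).
Proof. by rewrite /= src_id. Qed.
Fact incl_r_rng x f : grng (edge_r x f) = (x, grng f).
Proof. by rewrite /= rng_id. Qed.

Definition incl_l (w : obj G) : gmorph (skeleton L) P :=
  @GMorph _ _ (skeleton L) P (fun v => (v, w)) (edge_l w)
    (incl_l_src w) (incl_l_rng w).
Definition incl_r (x : obj L) : gmorph (skeleton G) P :=
  @GMorph _ _ (skeleton G) P (fun v => (x, v)) (edge_r x)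
    (incl_r_src x) (incl_r_rng x).
End ProductEdges.

(* qp_iso is the fixed identification of the one-skeletons. *)
Record quasi_product k1 k2 (L : kgraph k1) (G : kgraph k2)
    (O : kgraph (k1 + k2)) := QuasiProduct {
  qp_iso : ciso (skeleton (kprod L G)) (skeleton O);
  qp_psi1 : kfunctor L O;
  qp_psi2 : kfunctor G O;
  qp_psi1_inj : injective qp_psi1;
  qp_psi2_inj : injective qp_psi2;
  qp_deg1 : forall l, deg l = lsubmx (deg (qp_psi1 l));
  qp_deg2 : forall l, deg l = rsubmx (deg (qp_psi2 l))
}.

Section QuasiProductTheory.
Variables (k1 k2 : nat) (L : kgraph k1) (G : kgraph k2) (O : kgraph (k1 + k2)).

Definition Omega1 : {pred mor O} := [pred l | rsubmx (deg l) == 0].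
Definition Omega2 : {pred mor O} := [pred l | lsubmx (deg l) == 0].

Definition is_swap (l : mor O) (ba : mor O * mor O) : bool :=
  [&& ba.1 \in Omega2, ba.2 \in Omega1, src ba.1 == rng ba.2
    & l == comp ba.1 ba.2].

Lemma swap_exists l : exists ba, is_swap l ba.
Proof.
have : deg l = row_mx 0 (rsubmx (deg l)) + row_mx (lsubmx (deg l)) 0.
  by rewrite add_row_mx addr0 add0r hsubmxK.
move=> /factorization[[b a] [[/= h1 h2 h3 h4] _]]; exists (b, a).
by rewrite /is_swap !inE /= h3 h4 row_mxKl row_mxKr h1 -h2 !eqxx.
Qed.

Lemma swap_unique l ba ba' : is_swap l ba -> is_swap l ba' -> ba = ba'.
Proof.
case: ba ba' => b a [b' a'] /and4P[/= /eqP hb /eqP ha /eqP h1 /eqP h2].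
move=> /and4P[/= /eqP hb' /eqP ha' /eqP h1' /eqP h2'].
have e := h2; rewrite h2' in e.
have [d1 d2] : deg b' = deg b /\ deg a' = deg a.
  have := congr1 deg e; rewrite !deg_comp // -[deg b]hsubmxK -[deg b']hsubmxK.
  rewrite -[deg a]hsubmxK -[deg a']hsubmxK ha hb ha' hb' !add_row_mx.
  by rewrite !add0r !addr0 => /eq_row_mx[-> ->].
have d : deg l = deg b + deg a by rewrite h2 deg_comp.
have [x [_ u]] := factorization d.
by rewrite -(u (b, a)) // -(u (b', a')).
Qed.

(* The unique factorization of l as beta alpha, beta in Omega2, alpha in
   Omega1. *)
Definition swap (l : mor O) : mor O * mor O := xchoose (swap_exists l).

Lemma swapP l : is_swap l (swap l).
Proof. exact: xchooseP. Qed.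

Variable h : quasi_product L G O.
Let th : gmorph (skeleton (kprod L G)) (skeleton O) := qp_iso h.

(* ([p], w) and (x, [q]), as elements of Omega. *)
Definition rep_l (p : gpath (skeleton L)) (w : obj G) : mor O :=
  composite (path_map (qp_iso h) (path_map (incl_l L w) p)).
Definition rep_r (x : obj L) (q : gpath (skeleton G)) : mor O :=
  composite (path_map (qp_iso h) (path_map (incl_r G x) q)).

(* [q]_x *)
Definition fclass (x : obj L) (q : gpath (skeleton G)) :
    {pred gpath (skeleton G)} :=
  [pred q' | rep_r x q' == rep_r x q].

Lemma rep_l_src p w : src (rep_l p w) = gvert th (psrc p, w).
Proof. by rewrite composite_src !psrc_map. Qed.
Lemma rep_l_rng p w : rng (rep_l p w) = gvert th (prng p, w).
Proof. by rewrite composite_rng. Qed.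
Lemma rep_r_src x q : src (rep_r x q) = gvert th (x, psrc q).
Proof. by rewrite composite_src !psrc_map. Qed.
Lemma rep_r_rng x q : rng (rep_r x q) = gvert th (x, prng q).
Proof. by rewrite composite_rng. Qed.

Lemma color_l w e : color (gedge th (edge_l w e)) = row_mx (color e) 0.
Proof. by rewrite ciso_color /= deg_id. Qed.
Lemma color_r x f : color (gedge th (edge_r x f)) = row_mx 0 (color f).
Proof. by rewrite ciso_color /= deg_id. Qed.

Lemma rep_l_deg p w : rsubmx (deg (rep_l p w)) = 0.
Proof.
rewrite composite_deg /color_order /= -!map_comp.
elim: (pedges p) => [|e es IH] /=; first by rewrite big_nil linear0.
by rewrite big_cons [deg _](color_l w e) -[\sum_(_ <- _) _]hsubmxK IH add_row_mx addr0 row_mxKr.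
Qed.

Lemma rep_r_deg x q :
  deg (rep_r x q) = \sum_(c <- map (row_mx 0) (color_order q)) c.
Proof.
rewrite composite_deg /color_order /= -!map_comp; congr (\sum_(c <- _) c).
by apply: eq_map => f; exact: color_r.
Qed.

Lemma rep_r_degl x q : lsubmx (deg (rep_r x q)) = 0.
Proof.
rewrite rep_r_deg; elim: (color_order q) => [|e es IH] /=.
  by rewrite big_nil linear0.
by rewrite big_cons -[\sum_(_ <- _) _]hsubmxK IH add_row_mx addr0 row_mxKl.
Qed.

Lemma lift_walk_r (cs : seq 'rV[nat]_k2) x y (es : seq (edge (skeleton O))) :
  map color es = map (row_mx (0 : 'rV[nat]_k1)) cs ->
  is_walk (gvert th (x, y)) es ->
  exists fs, [/\ is_walk (G := skeleton G) y fs, map color fs = cs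
               & es = map (gedge th) (map (edge_r x) fs)].
Proof.
have [g _ gK] := ciso_edge_bij (qp_iso h).
have vinj := bij_inj (ciso_vert_bij (qp_iso h)).
elim: cs es y => [|c cs IH] [|e es] y //=; first by exists [::].
case=> hc hcs /andP[/eqP hr w].
have he : e = gedge th (g e) by rewrite gK.
move: (g e) he => {g gK}[[e1 e2] be] he; subst e.
have := ciso_color (qp_iso h) (exist _ (e1, e2) be); rewrite /= hc.
move=> /eq_row_mx[hd1 hd2].
have := gmorph_rng th (exist _ (e1, e2) be); rewrite /= hr => /vinj[hx hy].
have h1 : e1 = idm x by rewrite hx; apply: deg0_id.
have b2 : is_basis (deg e2).
  case/existsP: (be) => i /=; rewrite -hd1; case: (split_ordP i) => j ->.
    rewrite delta_mx_lshift => /eqP/eq_row_mx[/rowP/(_ j)].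
    by rewrite !mxE !eqxx.
  by rewrite delta_mx_rshift => /eqP/eq_row_mx[_ ->]; apply/existsP; exists j.
have hE : exist _ (e1, e2) be = edge_r x (exist _ e2 b2).
  by apply: val_inj; rewrite /= h1.
move: w; have := gmorph_src th (edge_r x (exist _ e2 b2)).
rewrite incl_r_src -hE /= => -> w.
have [fs [f1 f2 f3]] := IH _ _ hcs w.
exists (exist _ e2 b2 :: fs); split => /=; last by rewrite -f3 hE.
- by rewrite -hy eqxx.
- by rewrite f2 hd2.
Qed.

Lemma tri_exists (p : gpath (skeleton L)) (q : gpath (skeleton G)) : exists q',
  (color_order q' == color_order q) &&
  (rep_r (prng p) q' == (swap (comp (rep_l p (prng q)) (rep_r (psrc p) q))).1).
Proof.
set l := comp _ _; have := swapP l.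
case: (swap l) => b a /and4P[/= /eqP hb /eqP ha /eqP h1 /eqP h2].
have hs : src (rep_l p (prng q)) = rng (rep_r (psrc p) q).
  by rewrite rep_l_src rep_r_rng.
have hd : deg b = deg (rep_r (psrc p) q).
  have := congr1 deg h2; rewrite /l !deg_comp // -[deg b]hsubmxK.
  rewrite -[deg a]hsubmxK -[deg (rep_l _ _)]hsubmxK -[deg (rep_r _ _)]hsubmxK.
  rewrite ha hb rep_l_deg rep_r_degl !add_row_mx !add0r !addr0.
  by move=> /eq_row_mx[_ ->].
have hr : rng b = gvert th (prng p, prng q).
  by rewrite -rep_l_rng -(rng_comp hs) -/l h2 rng_comp.
rewrite rep_r_deg in hd.
have hB : all (@is_basis _) (map (row_mx (0 : 'rV[nat]_k1)) (color_order q)).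
  rewrite /color_order -map_comp all_map; apply/allP => f _ /=.
  by have := edge_r_subproof (prng p) f; rewrite /= deg_id.
have [es [w1 w2 w3]] := path_exists hB hd.
rewrite hr in w1; have [fs [f1 f2 f3]] := lift_walk_r w2 w1.
exists (@GPath _ (skeleton G) (prng q, fs) f1).
rewrite /color_order /pedges /= f2 eqxx /=; apply/eqP.
by rewrite /rep_r /composite /= /pedges /prng /= -f3 -hr w3.
Qed.

Lemma rep_r_inj x q q' :
  color_order q = color_order q' -> rep_r x q = rep_r x q' -> q = q'.
Proof.
move=> hc e.
have : path_map (qp_iso h) (path_map (incl_r G x) q) =
       path_map (qp_iso h) (path_map (incl_r G x) q').
  apply: path_unique => //; rewrite /color_order /= -!map_comp.
  have E : (color \o gedge (qp_iso h)) \o edge_r x =1 row_mx 0 \o color (c := skeleton G).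
    by move=> f; exact: color_r.
  by rewrite !(eq_map E) (map_comp _ _ (pedges q)) (map_comp _ _ (pedges q')) -!/(color_order _) hc.
case=> /(bij_inj (ciso_vert_bij (qp_iso h)))[hr].
move=> /(inj_map (bij_inj (ciso_edge_bij (qp_iso h)))) he.
have hp : pedges q = pedges q'.
  by apply: inj_map he => f f' [/val_inj].
apply: val_inj => /=; move: hr hp; rewrite /prng /pedges.
by case: (gpath_val q) (gpath_val q') => [? ?] [? ?] /= -> ->.
Qed.

(* p |> q *)
Definition tri (p : gpath (skeleton L)) (q : gpath (skeleton G)) :
    gpath (skeleton G) :=
  xchoose (tri_exists p q).

Lemma triP (p : gpath (skeleton L)) (q : gpath (skeleton G)) :
  color_order (tri p q) = color_order q /\
  rep_r (prng p) (tri p q) =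
    (swap (comp (rep_l p (prng q)) (rep_r (psrc p) q))).1.
Proof. by have /andP[/eqP-> /eqP->] := xchooseP (tri_exists p q). Qed.

Lemma tri_unique (p : gpath (skeleton L)) (q q' : gpath (skeleton G)) :
  color_order q' = color_order q ->
  rep_r (prng p) q' =
    (swap (comp (rep_l p (prng q)) (rep_r (psrc p) q))).1 ->
  q' = tri p q.
Proof.
by have [h1 h2] := triP p q; rewrite -h1 -h2; apply: rep_r_inj.
Qed.

Definition stable_quasi_factor : Prop := forall p q, tri p q = q.

End QuasiProductTheory.

(* Main.v *)
Require Import Defs.
From mathcomp Require Import all_boot all_order all_algebra.

(** Stability says that (x,[q]) at x = r(p) is the Omega_2-part of
    ([p],r(q))(s(p),[q]), hence depends only on p and the element (s(p),[q]):
    this gives one inclusion of classes.  For the other, each class contains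
    exactly one path of each admissible color order, so a path q' in [q]_r(p)
    coincides with the path in [q]_s(p) having the color order of q'. *)

Section FactorizationRules.
Variables (k1 k2 : nat) (L : kgraph k1) (G : kgraph k2) (O : kgraph (k1 + k2)).
Variable h : quasi_product L G O.

(** Factorization in [O] yields a path with colors [row_mx 0 c]; a walk from a vertex over [x] with
    only such colors never leaves the copy of G(Γ) at [x]. *)
Lemma rep_r_recolor (x : obj L) (q : gpath (skeleton G))
    (cs : seq 'rV[nat]_k2) :
  all (@is_basis k2) cs ->
  deg (rep_r h x q) = (\sum_(c <- map (row_mx 0) cs) c)%R ->
  exists2 q', color_order q' = cs & rep_r h x q' = rep_r h x q.
Proof.
move=> bcs hd.
have bcs0 : all (@is_basis _) (map (row_mx (0%R : 'rV[nat]_k1)) cs).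
  rewrite all_map; apply: sub_all bcs => c /existsP[i /eqP ->] /=.
  by apply/existsP; exists (rshift k1 i); rewrite delta_mx_rshift.
have [es [w1 w2 w3]] := path_exists bcs0 hd.
rewrite rep_r_rng in w1 w3.
have [fs [f1 f2 f3]] := lift_walk_r w2 w1.
exists (@GPath _ (skeleton G) (prng q, fs) f1) => //.
by rewrite -w3 f3.
Qed.

Lemma color_order_basis (q : gpath (skeleton G)) :
  all (@is_basis k2) (color_order q).
Proof. by rewrite all_map; apply/allP => f _; apply: (valP f). Qed.

Hypothesis hstable : stable_quasi_factor h.

Lemma stable_rep_r (p : gpath (skeleton L)) (q q' : gpath (skeleton G)) :
  rep_r h (psrc p) q' = rep_r h (psrc p) q ->
  rep_r h (prng p) q' = rep_r h (prng p) q.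
Proof.
(* The factor [rep_l p (prng q)] depends on the range of [q], so the ranges must be matched too. *)
move=> e; have := congr1 rng e; rewrite !rep_r_rng.
move=> /(bij_inj (ciso_vert_bij (qp_iso h)))[hr].
have [_] := triP h p q'; have [_] := triP h p q.
by rewrite !hstable e hr => -> ->.
Qed.

Lemma stable_fclass (p : gpath (skeleton L)) (q : gpath (skeleton G)) :
  fclass h (psrc p) q =i fclass h (prng p) q.
Proof.
move=> q'; rewrite !inE; apply/eqP/eqP; first exact: stable_rep_r.
move=> e.
(* Degrees see only color orders, so [e] at [prng p] gives this equality at [psrc p]. *)
have hd : deg (rep_r h (psrc p) q) =
    (\sum_(c <- map (row_mx 0) (color_order q')) c)%R.
  by rewrite rep_r_deg -(rep_r_deg h (prng p)) -e rep_r_deg.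
have [q2 hc e2] := rep_r_recolor _ _ _ (color_order_basis q') hd.
by rewrite -(@rep_r_inj _ _ _ _ _ h (prng p) q2 q') // e; apply: stable_rep_r.
Qed.

Lemma connected_stable_fclass :
  connected (skeleton L) ->
  forall (v w : obj L) (q : gpath (skeleton G)),
    fclass h v q =i fclass h w q.
Proof.
move=> hconn v w q; elim: (hconn v w) => {v w}.
- move=> _ _ [e [<- <-]] q'.
  (* Adjacent vertices are compared through the one-edge path [e]. *)
  have we : is_walk (grng e) [:: e] by rewrite /= eqxx.
  by rewrite -(stable_fclass (@GPath _ (skeleton L) (grng e, [:: e]) we)).
- by [].
- by move=> v w _ IH q'; rewrite IH.
- by move=> u v w _ IHu _ IHw q'; rewrite IHu.
Qed.

End FactorizationRules.

Theorem proposition3p11 (k1 k2 : nat) (Lambda : kgraph k1) (Gamma : kgraph k2)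
    (Omega : kgraph (k1 + k2)) (h : quasi_product Lambda Gamma Omega)
    (hstable : stable_quasi_factor h) :
  (forall (p : gpath (skeleton Lambda)) (q : gpath (skeleton Gamma)),
     fclass h (psrc p) q =i fclass h (prng p) q)
  /\
  (connected (skeleton Lambda) ->
   forall (v w : obj Lambda) (q : gpath (skeleton Gamma)),
     fclass h v q =i fclass h w q).
Proof.
split; first exact: stable_fclass.
exact: connected_stable_fclass.
Qed.
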